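(* Let $G$ be a finite simple connected graph with at least two vertices. Then the clique number of its spanning tree auxiliary graph is \[ \omega(Aux(G))=\max\{\,c(G),\ b(G)\,\}, \] where $c(G)$ is the circumference of $G$ and $b(G)$ is the maximum number of edges in a minimal edge cut of $G$.
   Context: For a finite simple connected graph $G$ on $n$ vertices, the spanning tree auxiliary graph $Aux(G)$ is the graph whose vertices are the spanning trees of $G$, two spanning trees being adjacent if and only if one is obtained from the other by a single unit transformation, i.e. by adding one edge of $G$ not in the tree and deleting a different edge so that the result is again a spanning tree; equivalently, the symmetric difference of their edge sets has exactly two edges (they share exactly $n-2$ of their $n-1$ edges). The circumference of $G$ is the length of a longest cycle of $G$ (taken to be $0$ if $G$ has no cycle). A minimal edge cut is an inclusion-minimal set of edges whose removal disconnects $G$. *)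

(* Defs.v *)
(* A finite simple graph is a symmetric irreflexive relation
   on a finType; sets of edges are sets of two-element vertex sets. *)
From mathcomp Require Import all_boot.

Set Implicit Arguments.
Unset Strict Implicit.
Unset Printing Implicit Defensive.

Section Graph.
Variable T : finType.
Implicit Types (e : rel T) (F K : {set {set T}}).

Definition connected_graph e : bool := [forall x, forall y, connect e x y].

(* Cycles are given by their cyclic vertex sequence, so the length (number of
   edges) of the cycle c is size c. *)
Definition is_cycle e (c : seq T) : bool := (2 < size c) && ucycleb e c.

Definition has_cycle_of_length e (k : nat) : bool :=
  [exists c : k.-tuple T, is_cycle e c].

(* The bound on k is harmless, since a cycle has at most #|T| vertices. *)
Definition acyclic e : bool :=
  [forall k : 'I_#|T|.+1, ~~ has_cycle_of_length e k].

Definition circumference e : nat :=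
  \max_(k < #|T|.+1 | has_cycle_of_length e k) k.

Definition edges e : {set {set T}} :=
  [set [set x; y] | x : T, y : T in [pred z | e x z]].

Definition graph_of F : rel T := [rel x y | [set x; y] \in F].

Definition spanning_tree e F : bool :=
  [&& F \subset edges e, connected_graph (graph_of F) & acyclic (graph_of F)].

Definition edge_cut e K : bool :=
  (K \subset edges e) && ~~ connected_graph (graph_of (edges e :\: K)).

Definition max_minimal_edge_cut e : nat :=
  \max_(K : {set {set T}} | minset (edge_cut e) K) #|K|.

Definition clique e (S : {set T}) : bool :=
  [forall x in S, forall y in S, (x != y) ==> e x y].

Definition clique_number e : nat := \max_(S : {set T} | clique e S) #|S|.

End Graph.

Definition aux_vertex (T : finType) (e : rel T) : finType :=
  {F : {set {set T}} | spanning_tree e F}.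

Arguments aux_vertex {T} e.

Definition Aux (T : finType) (e : rel T) : rel (aux_vertex e) :=
  [rel t1 t2 : aux_vertex e |
    [exists f in edges e :\: val t1, exists g in val t1,
      (g != f) && (val t2 == (f |: val t1) :\ g)]].

Arguments Aux {T} e.

(* Main.v *)
Require Import Defs.
From mathcomp Require Import all_boot zify.

Set Implicit Arguments.
Unset Strict Implicit.
Unset Printing Implicit Defensive.

(** The proof is written in terms of the cuts of vertex sets [A], where an edge
    crosses [A] when exactly one of its ends lies in [A].  Two observations make
    this language sufficient.  First, crossing is additive over the two-element
    field: an edge crosses the symmetric difference of [A] and [B] iff it
    crosses exactly one of them.  Secondly, both halves of the notion of
    spanning tree are cut conditions: a set of edges is connected iff every set
    that it does not cross is trivial, and it is acyclic iff each of its edges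
    [f] has a set [A] that is crossed by [f] and by no other edge of the set.
    The exchange property of spanning trees then becomes the one computation of
    [indep_add], and the only fact about cycles that is needed is that a cycle
    crosses every [A] an even number of times ([cycle_crossed_once]).

    Lower bound.  If [C] is the edge set of a cycle, [C] minus one edge is
    acyclic and extends to a spanning tree; adding the missing edge gives a set
    [U] such that the sets [U :\ f], for [f] in [C], are pairwise adjacent
    spanning trees ([cycle_leq_clique_number]).  If [K] is a minimal cut and [F]
    is a maximal acyclic set of edges outside [K], the sets [k |: F], for [k] in
    [K], are pairwise adjacent spanning trees ([cut_leq_clique_number]).

    Upper bound.  Two adjacent trees differ by the exchange of one edge, and a
    family of finite sets any two of which differ by the exchange of one element
    has one of two shapes ([exchange_family]): either its members are obtained
    from one set [U] by deleting an element, or they are obtained from one set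
    [I] by adding an element.  In the first case [U] contains a cycle, and each
    deleted edge has to be on it ([costar_leq_circumference]).  In the second
    case [I] is a tree minus an edge, hence has two components, and each added
    edge lies in the minimal cut between them ([star_leq_cut]). *)

(** * Cuts of a set of edges *)

Section Cuts.

Variable T : finType.
Implicit Types (A B f : {set T}) (F H : {set {set T}}).

(** The sum over [f] of the indicator function of [A] in the two-element field:
    for a two-element [f] this says that [A] separates its elements, and in this
    form it is additive in [A] for every [f]. *)
Definition crosses A f : bool := \big[addb/false]_(x in f) (x \in A).

Definition symdiff A B : {set T} := [set x | (x \in A) (+) (x \in B)].

Lemma crosses_symdiff A B f :
  crosses (symdiff A B) f = crosses A f (+) crosses B f.
Proof. by rewrite /crosses -big_split; apply: eq_bigr => x _; rewrite inE. Qed.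

Lemma crosses_set2 A x y :
  x != y -> crosses A [set x; y] = (x \in A) (+) (y \in A).
Proof. by move=> xy; rewrite /crosses big_setU1 ?big_set1 // inE. Qed.

Definition uncrossed F A := {in F, forall f, crosses A f = false}.

Definition unique_crossing F f A := {in F, forall g, crosses A g = (g == f)}.

Definition indep F : bool :=
  [forall f in F, exists A, [forall g in F, crosses A g == (g == f)]].

Lemma indepP F :
  reflect {in F, forall f, exists A, unique_crossing F f A} (indep F).
Proof.
apply: (iffP forall_inP) => indF f fF.
  have /existsP[A /forall_inP cutA] := indF f fF.
  by exists A => g gF; apply/eqP/cutA.
have [A cutA] := indF f fF.
by apply/existsP; exists A; apply/forall_inP => g gF; rewrite cutA.
Qed.

Lemma uncrossedS F H A : F \subset H -> uncrossed H A -> uncrossed F A.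
Proof. by move=> /subsetP FH unA f /FH; apply: unA. Qed.

Lemma uncrossedU1 F f A :
  crosses A f = false -> uncrossed F A -> uncrossed (f |: F) A.
Proof. by move=> fA unA g /setU1P[->|/unA]. Qed.

Lemma indepS F H : F \subset H -> indep H -> indep F.
Proof.
move=> /subsetP FH /indepP indH; apply/indepP => f /FH /indH[A cutA].
by exists A => g /FH; apply: cutA.
Qed.

(** If an edge [f] of [F] is the only one to cross [B], it keeps this property
    in [z |: F] unless [z] crosses [B] too; then adding [A] to [B] cancels the
    crossing of [z] and changes nothing on [F]. *)
Lemma indep_add F z A :
  indep F -> uncrossed F A -> crosses A z -> indep (z |: F).
Proof.
move=> /indepP indF unA zA.
have zNF f : f \in F -> (f == z) = false.
  by move=> fF; apply: contraTF zA => /eqP <-; rewrite unA.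
apply/indepP => f /setU1P[->|fF].
  by exists A => g /setU1P[->|gF]; rewrite ?eqxx // unA ?zNF.
have [B cutB] := indF f fF.
case zB: (crosses B z); last first.
  by exists B => g /setU1P[->|/cutB//]; rewrite zB eq_sym zNF.
exists (symdiff B A) => g /setU1P[->|gF]; rewrite crosses_symdiff.
  by rewrite zA zB eq_sym zNF.
by rewrite unA // addbF cutB.
Qed.

Lemma unique_crossing_del F f A :
  unique_crossing F f A -> uncrossed (F :\ f) A.
Proof. by move=> cutA g /setD1P[/negPf gf gF]; rewrite cutA. Qed.

(** The bases of the cycle matroid of [H].  A maximal independent subset [M] of
    [H] has the same uncrossed sets as [H], since an edge of [H] crossing a set
    that [M] does not cross could be added to [M]. *)
Lemma indep_extend F H : F \subset H -> indep F ->
  exists M : {set {set T}}, [/\ F \subset M, M \subset H, indep M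
              & forall A, uncrossed M A -> uncrossed H A].
Proof.
move=> FH indF.
have [|M /maxsetP[/andP[MH indM] maxM] FM] :=
  @maxset_exists _ (fun M : {set {set T}} => (M \subset H) && indep M) F.
  by rewrite FH indF.
exists M; split=> // A unA z zH; apply: contraTF isT => zA.
have zM: z \in M.
  rewrite -(maxM (z |: M)) ?setU11 ?subsetUr //.
  by rewrite subUset sub1set zH MH (indep_add indM unA).
by move: zA; rewrite unA.
Qed.

Definition spans F :=
  forall A, uncrossed F A -> forall x y, (x \in A) = (y \in A).

Lemma spansS F H : F \subset H -> spans F -> spans H.
Proof. by move=> FH spF A /(uncrossedS FH)/spF. Qed.

(** * Edges of a cycle *)

Lemma index_next (c : seq T) x : uniq c -> x \in c ->
  index (next c x) c =
    if (index x c).+1 == size c then 0 else (index x c).+1.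
Proof.
move=> Uc xc; case cE: c => [|a s]; first by rewrite cE in xc.
rewrite next_nth -cE xc cE -[nth a s _]/(nth a (a :: s) _.+1) -cE.
move: xc; rewrite -index_mem; case: eqVneq => [->|ni lt_i].
  by rewrite nth_default // cE /= eqxx.
by rewrite index_uniq // ltn_neqAle ni.
Qed.

Definition cyc_edges (c : seq T) : {set {set T}} :=
  [set [set x; next c x] | x in c].

Lemma next_neq (c : seq T) x : 1 < size c -> uniq c -> x \in c -> x != next c x.
Proof.
move=> sc Uc xc; apply/eqP => /(congr1 (index^~ c)); rewrite index_next //.
by case: eqP; lia.
Qed.

Lemma set2_eq (x y u v : T) : [set x; y] = [set u; v] ->
  (x = u /\ y = v) \/ (x = v /\ y = u).
Proof.
move=> E; have := set21 x y; have := set22 x y; have := set21 u v.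
have := set22 u v; rewrite E -{1 2}E.
move=> /set2P[]vE /set2P[]uE /set2P[]yE /set2P[]xE; subst; auto.
Qed.

(** Two positions with the same edge would be each other's successors, which a
    cycle of length at least 3 excludes. *)
Lemma cyc_edge_inj (c : seq T) : 2 < size c -> uniq c ->
  {in c &, injective (fun x => [set x; next c x])}.
Proof.
move=> sc Uc x y xc yc /set2_eq[[]//|[xE yE]].
have ny: next c y \in c by rewrite mem_next.
have := congr1 (index^~ c) yE; rewrite /= xE.
have := index_mem y c; rewrite yc !index_next //.
by case: eqP; case: eqP; lia.
Qed.

Lemma card_cyc_edges (c : seq T) :
  2 < size c -> uniq c -> #|cyc_edges c| = size c.
Proof.
by move=> sc Uc; rewrite card_in_imset ?(card_uniqP Uc) //; apply: cyc_edge_inj.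
Qed.

(** A cycle cannot cross [A] at [f] only: summed over the positions of the
    cycle, the crossings amount to the sum of the indicator of [A] plus its sum
    along the rotated cycle, which cancel. *)
Lemma cycle_crossed_once (c : seq T) f A : 2 < size c -> uniq c ->
  uncrossed (cyc_edges c :\ f) A -> f \in cyc_edges c -> crosses A f = false.
Proof.
move=> sc Uc unA /imsetP[x xc fE].
have even : \big[addb/false]_(y <- c) crosses A [set y; next c y] = false.
  have nn y : y \in c -> y != next c y by apply: next_neq => //; lia.
  rewrite (eq_big_seq _ (fun y yc => crosses_set2 A (nn y yc))) big_split /=.
  rewrite -(big_map (next c) xpredT (fun y => y \in A)) /=.
  have nextC: perm_eq (map (next c) c) c.
    apply: uniq_perm => //.
      by rewrite (map_inj_uniq (can_inj (prev_next Uc))).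
    move=> y; apply/mapP/idP => [[z zc ->]|yc]; first by rewrite mem_next.
    by exists (prev c y); rewrite ?mem_prev // next_prev.
  by rewrite (perm_big _ nextC) addbb.
move: even; rewrite (bigD1_seq x) //= -fE big1_seq ?addbF // => y /andP[yx yc].
apply: unA; apply/setD1P; split; last exact: imset_f.
by apply: contra yx; rewrite fE => /eqP/(cyc_edge_inj sc Uc)->.
Qed.

Lemma spans_del_cyc F (c : seq T) f : 2 < size c -> uniq c ->
  cyc_edges c \subset F -> f \in cyc_edges c -> spans F -> spans (F :\ f).
Proof.
move=> sc Uc cF fc spF A unA; apply: spF.
rewrite -(setD1K (subsetP cF f fc)); apply: uncrossedU1 => //.
by apply: (cycle_crossed_once sc) fc => //; apply: uncrossedS unA;
  rewrite setSD.
Qed.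

Lemma indep_no_cycle F (c : seq T) : 2 < size c -> uniq c ->
  cyc_edges c \subset F -> indep F -> False.
Proof.
case: c => // a s; set c := a :: s => sc Uc cF /indepP indF.
have fc : [set a; next c a] \in cyc_edges c by apply: imset_f; rewrite mem_head.
have [A cutA] := indF _ (subsetP cF _ fc).
have := cutA _ (subsetP cF _ fc); rewrite eqxx (cycle_crossed_once sc Uc) //.
by apply: uncrossedS (unique_crossing_del cutA); rewrite setSD.
Qed.

(** Deleting the closing edge of a cycle leaves a path, and each edge of a path
    is the only one to leave the initial segment of the vertices up to it. *)
Lemma indep_path_edges (c : seq T) x0 : 2 < size c -> uniq c ->
  x0 \in c -> (index x0 c).+1 = size c ->
  indep (cyc_edges c :\ [set x0; next c x0]).
Proof.
move=> sc Uc x0c ix0; apply/indepP => f /setD1P[fx0 /imsetP[y yc fE]].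
exists [set z | index z c <= index y c] => g /setD1P[gx0 /imsetP[z zc gE]].
have ne w : w \in c -> [set w; next c w] != [set x0; next c x0] ->
    (index w c).+1 != size c.
  move=> wc; apply: contra => /eqP iw; apply/eqP;
    congr (fun w => [set w; next c w]).
  rewrite -(nth_index x0 wc) -[RHS](nth_index x0 x0c); congr (nth _ _ _); lia.
rewrite gE fE (inj_in_eq (cyc_edge_inj sc Uc)) //.
rewrite crosses_set2; last by apply: next_neq => //; lia.
rewrite !inE index_next // (negPf (ne z zc _)) -?gE //.
have -> : (z == y) = (index z c == index y c).
  by apply/eqP/eqP => [->//|E]; rewrite -(nth_index x0 zc) E nth_index.
by case: ltngtP; lia.
Qed.

End Cuts.

(** * Families of sets pairwise related by one exchange *)

(** Two members [A0 = I + g] and [B0 = I + f] fix the candidates [A0 :|: B0] and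
    [I = A0 :&: B0].  A member [C] outside [A0 :|: B0] has to be [I + h] with a
    new [h]; a member missing some [x] of [I] has to contain both [f] and [g],
    so it would differ from [C] by two elements.  The nonemptiness of the
    members serves families of one set, which are of the second kind. *)
Lemma exchange_family (X : finType) (S : {set {set X}}) A0 :
  A0 \in S -> {in S, forall A, A != set0} ->
  {in S &, forall A B, A != B -> exists x, A :\: B = [set x]} ->
  (exists2 U : {set X}, U \subset cover S &
     {in S, forall A, exists2 x, x \in U & A = U :\ x}) \/
  (exists I : {set X}, {in S, forall A, exists2 x, x \notin I & A = x |: I}).
Proof.
move=> A0S Sn0 adjS.
have diff_uniq A B x y : A \in S -> B \in S ->
    x \in A -> x \notin B -> y \in A -> y \notin B -> x = y.
  move=> AS BS xA xB yA yB.
  have [|z zE] := adjS A B AS BS; first by apply: contraNneq xB => <-.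
  have /set1P-> : x \in [set z] by rewrite -zE inE xB.
  by apply/esym/set1P; rewrite -zE inE yB.
have [B0 /andP[B0S nBA]|only] := pickP [pred B in S | B != A0]; last first.
  right; have /set0Pn[x xA] := Sn0 _ A0S.
  exists (A0 :\ x) => A AS; have/eqP-> : A == A0.
    by apply: contraFT (only A) => nA; rewrite /= AS.
  by exists x; rewrite ?setD1K // !inE eqxx.
have [|g gE] := adjS A0 B0 A0S B0S; first by rewrite eq_sym.
have [f fE] := adjS _ _ B0S A0S nBA.
have /setDP[gA gB] : g \in A0 :\: B0 by rewrite gE set11.
have /setDP[fB fA] : f \in B0 :\: A0 by rewrite fE set11.
have [/forall_inP subU|] := boolP [forall A in S, A \subset A0 :|: B0].
  left; exists (A0 :|: B0) => [|A AS].
    by rewrite subUset !(bigcup_sup _).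
  suff [k kE]: exists k, (A0 :|: B0) :\: A = [set k].
    have kU : k \in (A0 :|: B0) :\: A by rewrite kE set11.
    exists k; first by case/setDP: kU.
    by rewrite -kE setDDr setDv set0U; apply/esym/setIidPr/subU.
  rewrite setDUl; case: (eqVneq A A0) => [->|nA].
    by exists f; rewrite setDv set0U.
  have [|k kE] := adjS A0 A A0S AS; first by rewrite eq_sym.
  exists k; rewrite -kE; apply/setUidPl/subsetP => y /setDP[yB yA].
  rewrite inE yA; apply: contraNT yA => yA0.
  have [h hE] := adjS _ _ AS A0S nA.
  have /setDP[hA hA0] : h \in A :\: A0 by rewrite hE set11.
  have hB : h \in B0.
    by have := subsetP (subU A AS) h hA; rewrite inE (negPf hA0).
  by rewrite (diff_uniq B0 A0 y h).
move=> /forall_inPn[C CS /subsetPn[h hC]]; rewrite inE => /norP[hA hB].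
right; exists (A0 :&: B0) => A AS.
have gNC : g \notin C.
  by apply/negP => gC; move: hA; rewrite (diff_uniq C B0 h g) ?gA.
have fNC : f \notin C.
  by apply/negP => fC; move: hB; rewrite (diff_uniq C A0 h f) ?fB.
(* An element [x] of [A0 :&: B0] missing from [A] would be the only one that [A]
   misses from [A0] or from [B0], so [f] and [g] would both be in [A], whereas
   neither is in [C]. *)
have subA : A0 :&: B0 \subset A.
  apply/subsetP => x /setIP[xA xB]; apply: contraTT isT => xNA.
  have xC : x \in C.
    by apply: contraT => xNC; move: gB; rewrite (diff_uniq A0 C g x) ?xB.
  have gA' : g \in A.
    by apply: contraT => gNA; move: gNC; rewrite (diff_uniq A0 A g x) ?xC.
  have fA' : f \in A.
    by apply: contraT => fNA; move: fNC; rewrite (diff_uniq B0 A f x) ?xC.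
  by move: fA; rewrite (diff_uniq A C f g) ?gA.
suff [k kE]: exists k, A :\: (A0 :&: B0) = [set k].
  have kI : k \in A :\: (A0 :&: B0) by rewrite kE set11.
  exists k; first by case/setDP: kI.
  by rewrite -kE setUC -[LHS](setID A (A0 :&: B0)) (setIidPr subA).
rewrite setDIr; case: (eqVneq A A0) => [->|nA].
  by exists g; rewrite setDv set0U.
have [k kE] := adjS _ _ AS A0S nA.
exists k; rewrite kE; apply/setUidPl; rewrite -kE.
apply/subsetP => y /setDP[yA yB]; rewrite inE yA andbT; apply/negP => yA0.
have [|l lE] := adjS A0 A A0S AS; first by rewrite eq_sym.
have /setDP[lA0 /negP[]] : l \in A0 :\: A by rewrite lE set11.
case lB: (l \in B0); first by apply: (subsetP subA); rewrite inE lA0.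
by rewrite (diff_uniq A0 B0 l y) ?lB.
Qed.

(** * Spanning trees as independent spanning sets of edges *)

Section SpanningTrees.

Variables (T : finType) (e : rel T).
Hypotheses (e_sym : symmetric e) (e_irr : irreflexive e).
Implicit Types (A f : {set T}) (F H K : {set {set T}}).

Lemma edgesP f :
  reflect (exists x y, [/\ e x y, x != y & f = [set x; y]]) (f \in edges e).
Proof.
apply: (iffP imset2P) => [[x y _ exy ->]|[x [y [exy _ ->]]]];
  last by exists x y.
by exists x, y; split=> //; apply: contraTneq exy => ->; rewrite inE e_irr.
Qed.

Lemma mem_edges x y : ([set x; y] \in edges e) = e x y.
Proof.
apply/edgesP/idP => [[u [v [euv _ xyE]]]|exy]; last first.
  by exists x, y; split=> //; apply: contraTneq exy => ->; rewrite e_irr.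
by have [[-> ->]|[-> ->]] := set2_eq xyE; rewrite // e_sym.
Qed.

Lemma graph_ofE F x y : graph_of F x y = ([set x; y] \in F).
Proof. by []. Qed.

Lemma graph_of_sym F : symmetric (graph_of F).
Proof. by move=> x y; rewrite !graph_ofE setUC. Qed.

Lemma connect_uncrossed F x : F \subset edges e ->
  uncrossed F [set y | connect (graph_of F) x y].
Proof.
move=> /subsetP FE f fF; have /edgesP[u [v [_ uv fE]]] := FE f fF.
rewrite fE crosses_set2 // !inE.
have uvF : graph_of F u v by rewrite graph_ofE -fE.
rewrite (same_connect_r (sym_connect_sym (graph_of_sym F)) (connect1 uvF)).
exact: addbb.
Qed.

(** Membership in an uncrossed set is constant along paths; conversely the
    component of a vertex is an uncrossed set, by [connect_uncrossed]. *)
Lemma connected_spans F : F \subset edges e ->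
  connected_graph (graph_of F) <-> spans F.
Proof.
move=> FE; split=> [conF A unA x y|spF].
  have /forallP/(_ y) xy := forallP conF x.
  apply: (closed_connect _ xy) => u v; rewrite graph_ofE => uvF.
  case: (eqVneq u v) => [->//|uv].
  by have := unA _ uvF; rewrite crosses_set2 //; do 2!case: (_ \in A).
apply/forallP => x; apply/forallP => y.
have := spF _ (connect_uncrossed x FE) x y.
by rewrite !inE connect0 => <-.
Qed.

Lemma spans_uncrossed F A : spans F -> uncrossed F A -> uncrossed (edges e) A.
Proof.
move=> spF unA f /edgesP[x [y [_ xy ->]]].
by rewrite crosses_set2 // (spF A unA x y) addbb.
Qed.

Lemma cyc_edges_sub F (c : seq T) :
  is_cycle (graph_of F) c -> cyc_edges c \subset F.
Proof.
move=> /and3P[_ cycF Uc]; apply/subsetP => _ /imsetP[x xc ->].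
exact: (next_cycle cycF).
Qed.

Lemma indep_acyclic F : indep F -> acyclic (graph_of F).
Proof.
move=> indF; apply/forallP => k; apply/existsPn => c; apply/negP => cycF.
have /and3P[sc _ Uc] := cycF.
exact: indep_no_cycle sc Uc (cyc_edges_sub cycF) indF.
Qed.

Lemma is_cycle_bound (r : rel T) (c : seq T) : is_cycle r c ->
  exists2 k : 'I_#|T|.+1, k = size c :> nat & has_cycle_of_length r k.
Proof.
move=> cyc; have /and3P[_ _ Uc] := cyc.
have lt_c : size c < #|T|.+1 by rewrite ltnS -(card_uniqP Uc) max_card.
by exists (Ordinal lt_c) => //; apply/existsP; exists (in_tuple c).
Qed.

(** The set crossed by [f = {x, y}] alone is the component of [x] in [F :\ f]:
    were [y] in it, a path from [x] to [y] closed by [f] would be a cycle. *)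
Lemma acyclic_indep F : F \subset edges e -> acyclic (graph_of F) -> indep F.
Proof.
move=> FE acF; apply/indepP => f fF.
have /edgesP[x [y [_ xy fE]]] := subsetP FE f fF.
have delE : F :\ f \subset edges e by apply: subset_trans FE; apply: subD1set.
exists [set z | connect (graph_of (F :\ f)) x z] => g gF.
case: (eqVneq g f) => [->|gf]; last first.
  by apply: connect_uncrossed => //; rewrite !inE gf.
rewrite [X in crosses _ X]fE crosses_set2 // !inE connect0 /=;
  apply/negP => /connectP[p xp yE].
case: (shortenP xp) yE => q xq Uq _ yE {p xp}.
have subF : subrel (graph_of (F :\ f)) (graph_of F).
  by move=> u v; rewrite !graph_ofE => /setD1P[].
have cyc : is_cycle (graph_of F) (x :: q).
  apply/and3P; split=> //.
    case: q xq yE {Uq} => [|z [|//]] /=.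
      by move=> _ /eqP; rewrite eq_sym (negPf xy).
    by rewrite andbT => + yz; rewrite -yz => /setD1P[]; rewrite fE eqxx.
  by rewrite /= rcons_path (sub_path subF xq) -yE graph_ofE setUC -fE.
have [k _ kF] := is_cycle_bound cyc.
by have := forallP acF k; rewrite kF.
Qed.

Lemma spanning_treeP F : reflect [/\ F \subset edges e, spans F & indep F]
  (spanning_tree e F).
Proof.
apply: (iffP and3P) =>
  [[FE /(connected_spans FE) ? /(acyclic_indep FE)]|[FE spF indF]].
  by split.
by split=> //; [apply/connected_spans|apply: indep_acyclic].
Qed.

Lemma edge_cutP K :
  reflect (K \subset edges e /\ ~ spans (edges e :\: K)) (edge_cut e K).
Proof.
have DE := subsetDl (edges e) K.
apply: (iffP andP) => [] [KE H]; split=> //.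
  by move/(connected_spans DE); apply/negP.
by apply/negP => /(connected_spans DE).
Qed.

Lemma circumference_geq (c : seq T) : is_cycle e c -> size c <= circumference e.
Proof. by move=> /is_cycle_bound[k <- ke]; apply: leq_bigmax_cond. Qed.

Lemma Aux_diff (t1 t2 : aux_vertex e) :
  Aux e t1 t2 -> exists x, val t1 :\: val t2 = [set x].
Proof.
move=> /exists_inP[f /setDP[_ ft] /exists_inP[g gt /andP[gf /eqP->]]].
exists g; apply/setP => x; rewrite !inE.
by case: (eqVneq x g) => [->|_]; rewrite ?gt //=; case: (x \in val t1);
  rewrite ?orbT ?andbF.
Qed.

(** * Cliques of spanning trees from cycles and cuts *)

Lemma clique_number_geq (I : finType) (D : {set I}) (t : I -> {set {set T}}) :
  {in D, forall i, spanning_tree e (t i)} ->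
  {in D &, forall i j, i != j -> exists f g,
     [/\ f \in t j, f \notin t i, g \in t i, g != f & t j = (f |: t i) :\ g]} ->
  #|D| <= clique_number (Aux e).
Proof.
move=> tD adj.
pose S : {set aux_vertex e} := [set s | val s \in t @: D].
have injt : {in D &, injective t}.
  move=> i j iD jD tij; apply: contraTeq isT => ij.
  by have [f [g [fj fi _ _ _]]] := adj i j iD jD ij; rewrite tij fj in fi.
have -> : #|D| = #|S|.
  rewrite -(card_in_imset injt) -(card_imset (mem S) val_inj).
  apply: eq_card => F; apply/idP/imsetP => [FD|[s]]; last first.
    by rewrite inE => sD ->.
  have treeF : spanning_tree e F by case/imsetP: FD => i /tD ti ->.
  by exists (Sub F treeF); rewrite ?inE.
apply: (leq_bigmax_cond (F := fun S : {set aux_vertex e} => #|S|)).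
apply/forall_inP => s1; rewrite inE => /imsetP[i iD s1E].
apply/forall_inP => s2; rewrite inE => /imsetP[j jD s2E].
apply/implyP => s12; have ij : i != j.
  by apply: contraNneq s12 => ij; apply/eqP/val_inj; rewrite s1E s2E ij.
have [f [g [fj fi gi gf tjE]]] := adj i j iD jD ij.
apply/exists_inP; exists f; last first.
  by apply/exists_inP; exists g; rewrite ?s1E // gf s2E tjE eqxx.
have /spanning_treeP[/subsetP tE _ _] := tD j jD.
by rewrite s1E inE fi tE.
Qed.

Hypothesis spE : spans (edges e).

(** [T0] is a spanning tree containing all edges of the cycle but [f0].  In
    [U = f0 |: T0] the whole cycle is present, so that deleting any one of its
    edges preserves connectedness. *)
Lemma cycle_leq_clique_number (c : seq T) :
  is_cycle e c -> size c <= clique_number (Aux e).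
Proof.
move=> /and3P[sc cyce Uc].
have cE : cyc_edges c \subset edges e.
  by apply/subsetP => _ /imsetP[x xc ->]; rewrite mem_edges;
    apply: next_cycle cyce xc.
(* [x0] is the last vertex, so that [f0] is the closing edge of the cycle. *)
have [x0 x0c ix0] : exists2 x0, x0 \in c & (index x0 c).+1 = size c.
  case: c sc Uc {cyce cE} => // a s _ Uc.
  by exists (last a s); rewrite ?mem_last ?index_last.
set f0 := [set x0; next c x0]; have f0c : f0 \in cyc_edges c by apply: imset_f.
have [|T0 [cT0 T0E indT0 maxT0]] :=
  indep_extend _ (indep_path_edges sc Uc x0c ix0) (H := edges e).
  by apply: subset_trans cE; apply: subD1set.
have spT0 : spans T0 by move=> A /maxT0; apply: spE.
have cU : cyc_edges c \subset f0 |: T0.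
  by rewrite -(setD1K f0c) setUS.
have f0T0 : f0 \notin T0.
  apply/negP => f0T0; apply: (indep_no_cycle sc Uc _ indT0).
  by rewrite -(setD1K f0c) subUset sub1set f0T0.
rewrite -(card_cyc_edges sc Uc).
apply: (clique_number_geq (t := fun f => (f0 |: T0) :\ f)) =>
  [f fc|f g fc gc fg].
  have spU : spans ((f0 |: T0) :\ f).
    by apply: (spans_del_cyc sc Uc) => //; apply: spansS spT0; apply: subsetUr.
  apply/spanning_treeP; split=> //.
    apply: subset_trans (subD1set _ _) _.
    by rewrite subUset sub1set T0E (subsetP cE).
  case: (eqVneq f f0) => [->|ff0]; first by rewrite setU1K.
  have fT0 : f \in T0.
    by have := subsetP cU f fc; rewrite in_setU1 (negPf ff0).
  have [A cutA] := indepP _ indT0 f fT0.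
  have unA := unique_crossing_del cutA.
  (* [A] is crossed in [T0] by [f] only; since [U :\ f] is connected, [f0] has
     to cross it as well, so [f0] can replace [f]. *)
  have UfE : (f0 |: T0) :\ f = f0 |: (T0 :\ f).
    by apply/setP => h; rewrite !inE; case: (eqVneq h f0) => // ->;
      rewrite eq_sym ff0.
  rewrite UfE; apply: (indep_add _ unA).
    by apply: indepS indT0; apply: subD1set.
  apply: contraT => /negbTE f0A.
  have := spans_uncrossed spU (A := A).
  rewrite UfE => /(_ (uncrossedU1 f0A unA) f).
  by rewrite (subsetP cE) // cutA // eqxx => /(_ isT).
have fU := subsetP cU f fc; have gU := subsetP cU g gc.
exists f, g; split.
- by rewrite in_setD1 fg.
- by rewrite !inE eqxx.
- by rewrite in_setD1 eq_sym fg.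
- by rewrite eq_sym.
- by rewrite setD1K.
Qed.

(** A spanning forest [F] of the complement of [K] has the same uncrossed sets
    as this complement.  So [k |: F] is connected because, by minimality,
    putting [k] back reconnects the graph; and it is acyclic because some set
    that [F] does not cross is crossed by [k], or else the complement of [K]
    would be connected as well. *)
Lemma cut_leq_clique_number K :
  minset (edge_cut e) K -> #|K| <= clique_number (Aux e).
Proof.
move=> /minsetP[/edge_cutP[KE cutK] minK].
have ind0 : indep (set0 : {set {set T}}) by apply/indepP => f; rewrite inE.
have [F [_ FH indF maxF]] := indep_extend (sub0set (edges e :\: K)) ind0.
have FE : F \subset edges e by apply: subset_trans FH (subsetDl _ _).
have FNK k : k \in K -> k \notin F.
  by move=> kK; apply/negP => /(subsetP FH); rewrite inE kK.
have spk k : k \in K -> spans (k |: F).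
  move=> kK A unA.
  have spK : spans (edges e :\: (K :\ k)).
    apply/(connected_spans (subsetDl _ _)); apply: contraT => ncon.
    have cutk : edge_cut e (K :\ k).
      by rewrite /edge_cut ncon (subset_trans (subD1set _ _)).
    by have := minK _ cutk (subD1set _ _) => /setP/(_ k); rewrite !inE eqxx kK.
  apply: spK => f; rewrite !inE negb_and negbK => /andP[/orP[/eqP->|fK] fE].
    by apply: unA; apply: setU11.
  apply: (maxF A _ f); last by rewrite inE fK.
  by apply: uncrossedS unA; apply: subsetUr.
apply: (clique_number_geq (t := fun k => k |: F)) => [k kK|k l kK lK kl].
  apply/spanning_treeP; split; first by rewrite subUset sub1set FE (subsetP KE).
    exact: spk.
  have [/existsP[A /andP[/forall_inP unA kA]]|no_cut] :=
      boolP [exists A, [forall f in F, ~~ crosses A f] && crosses A k].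
    by apply: (indep_add indF _ kA) => f /unA/negbTE.
  case: cutK => A /(uncrossedS FH) unA.
  apply: (spk k kK); apply: uncrossedU1 => //.
  apply: contraNF no_cut => kA; apply/existsP; exists A; rewrite kA andbT.
  by apply/forall_inP => f /unA->.
exists l, k; split.
- exact: setU11.
- by rewrite in_setU1 eq_sym (negPf kl) FNK.
- exact: setU11.
- by [].
by rewrite setUCA setU1K // in_setU1 (negPf kl) FNK.
Qed.

(** * Bounds on the two kinds of cliques *)

(** In the tree [x0 |: I] only [x0] crosses [A]; so [I] does not cross [A], and
    every edge completing [I] to a tree does.  The cut [K] of [A] is minimal
    because each side of [A] is connected by [I]: if [B] is crossed by [x0] and
    not by [I], then the tree [x0 |: I] does not cross the symmetric difference
    of [A] and [B], so no edge does, and every edge of [K] crosses [B]. *)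
Lemma star_leq_cut (I : {set {set T}}) (S : {set {set {set T}}}) :
  {in S, forall t, spanning_tree e t} ->
  {in S, forall t, exists2 x, x \notin I & t = x |: I} ->
  #|S| <= max_minimal_edge_cut e.
Proof.
move=> treeS starS.
have [->|[t0 t0S]] := set_0Vmem S; first by rewrite cards0.
have [x0 x0I t0E] := starS _ t0S.
have /spanning_treeP[] := treeS _ t0S; rewrite t0E => t0sub spt0 indt0.
have [A cutA] := indepP _ indt0 x0 (setU11 _ _).
have x0A : crosses A x0 by rewrite cutA ?setU11 ?eqxx.
have unA : uncrossed I A by rewrite -(setU1K x0I); apply: unique_crossing_del.
pose K := [set k in edges e | crosses A k].
have KE : K \subset edges e by apply/subsetP => k; rewrite inE => /andP[].
have IE : I \subset edges e by apply: subset_trans t0sub; apply: subsetUr.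
have x0E : x0 \in edges e by rewrite (subsetP t0sub) ?setU11.
have minK : minset (edge_cut e) K.
  apply/minsetP; split.
    apply/edge_cutP; split=> // spK; have := spans_uncrossed spK (A := A).
    move=> /(_ _ x0 x0E); rewrite x0A => H; suff: true = false by [].
    by apply: H => f; rewrite !inE negb_and => /andP[/orP[/negPf->|/negPf]].
  move=> K' /edge_cutP[K'E cutK'] K'K; apply/eqP; rewrite eqEsubset K'K.
  apply/subsetP => k kK; apply: contraT => kK'; case: cutK' => B unB.
  have kA : crosses A k by move: kK; rewrite inE => /andP[].
  have kE := subsetP KE k kK.
  have kB : crosses B k = false by rewrite unB // inE kK' kE.
  have IB : uncrossed I B.
    move=> f fI; apply: unB; rewrite inE (subsetP IE) // andbT.
    by apply: contraTN isT => /(subsetP K'K); rewrite inE unA // andbF.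
  apply: (spt0); apply: uncrossedU1 => //; apply: contraTF kA => x0B.
  rewrite -[crosses A k]addFb -kB -crosses_symdiff.
  rewrite (spans_uncrossed spt0) // => f /setU1P[->|fI];
    rewrite crosses_symdiff.
    by rewrite x0A x0B.
  by rewrite IB ?unA.
apply: leq_trans (leq_bigmax_cond (F := fun K : {set {set T}} => #|K|) K minK).
have SK : S \subset [set k |: I | k in K].
  apply/subsetP => t tS; have [x xI tE] := starS t tS.
  have /spanning_treeP[tsub spt _] := treeS t tS.
  rewrite tE; apply: imset_f; rewrite inE (subsetP tsub) ?tE ?setU11 //.
  apply: contraT => /negbTE xA; rewrite tE in spt.
  by have := spans_uncrossed spt (uncrossedU1 xA unA) x0E; rewrite x0A.
exact: leq_trans (subset_leq_card SK) (leq_imset_card _ _).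
Qed.

(** [U] contains a cycle, because [x0] cannot be the only edge of [U] to cross a
    set when [U :\ x0] is connected.  A tree [U :\ x] does not contain this
    cycle, so [x] is one of its edges. *)
Lemma costar_leq_circumference (U : {set {set T}}) (S : {set {set {set T}}}) :
  U \subset edges e ->
  {in S, forall t, spanning_tree e t} ->
  {in S, forall t, exists2 x, x \in U & t = U :\ x} ->
  #|S| <= circumference e.
Proof.
move=> UE treeS costarS.
have [->|[t0 t0S]] := set_0Vmem S; first by rewrite cards0.
have [x0 x0U t0E] := costarS _ t0S.
have /spanning_treeP[] := treeS _ t0S; rewrite t0E => _ spt0 _.
have cyclicU : ~~ acyclic (graph_of U).
  apply/negP => /(acyclic_indep UE)/indepP/(_ x0 x0U)[A cutA].
  have := spans_uncrossed spt0 (unique_crossing_del cutA) (subsetP UE _ x0U).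
  by rewrite cutA ?eqxx.
have /forallPn[k] := cyclicU; rewrite negbK => /existsP[c cycU].
have /and3P[sc pc Uc] := cycU; have cU := cyc_edges_sub cycU.
have cyce : is_cycle e c.
  apply/and3P; split=> //; apply: sub_cycle pc => x y;
    rewrite graph_ofE => /(subsetP UE).
  by rewrite mem_edges.
apply: leq_trans (circumference_geq cyce); rewrite -(card_cyc_edges sc Uc).
have Sc : S \subset [set U :\ f | f in cyc_edges c].
  apply/subsetP => t tS; have [x xU tE] := costarS t tS.
  have /spanning_treeP[_ _ indt] := treeS t tS.
  rewrite tE; apply: imset_f; apply: contraT => xc.
  case: (indep_no_cycle sc Uc _ indt).
  by rewrite tE subsetD1 cU.
exact: leq_trans (subset_leq_card Sc) (leq_imset_card _ _).
Qed.

Lemma spanning_tree_neq0 F : 1 < #|T| -> spanning_tree e F -> F != set0.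
Proof.
move=> /card_gt1P[x [y [_ _ xy]]] /spanning_treeP[_ spF _].
apply: contraNneq xy => F0; have := spF [set x] _ x y; rewrite !inE eqxx.
by rewrite eq_sym => <- // f; rewrite F0 inE.
Qed.

End SpanningTrees.

Theorem lemma13 (T : finType) (e : rel T)
  (e_sym : symmetric e) (e_irr : irreflexive e)
  (e_conn : connected_graph e) (T_gt1 : 1 < #|T|) :
  clique_number (Aux e) =
    maxn (circumference e) (max_minimal_edge_cut e).
Proof.
have spE : spans (edges e).
  apply/(connected_spans e_irr (subxx _)).
  apply/forallP => x; apply/forallP => y.
  have /forallP/(_ y) := forallP e_conn x.
  rewrite (@eq_connect _ _ e) // => u v.
  exact: mem_edges.
apply/eqP; rewrite eqn_leq geq_max; apply/and3P; split.
- apply/bigmax_leqP => S cliqueS.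
  rewrite -(card_imset _ val_inj); set S' := val @: S.
  have treeS : {in S', forall t, spanning_tree e t}.
    by move=> _ /imsetP[s _ ->]; apply: valP.
  have adjS : {in S' &, forall A B, A != B -> exists x, A :\: B = [set x]}.
    move=> _ _ /imsetP[s sS ->] /imsetP[t tS ->] st.
    apply: Aux_diff.
    have /forall_inP/(_ t tS)/implyP := forall_inP cliqueS s sS.
    by apply; apply: contraNneq st => ->.
  have [->|[t0 t0S]] := set_0Vmem S'; first by rewrite cards0.
  have n0 : {in S', forall t, t != set0}.
    by move=> t /treeS; apply: spanning_tree_neq0.
  have [[U UE costar]|[I star]] := exchange_family t0S n0 adjS.
    rewrite leq_max (costar_leq_circumference e_sym e_irr _ treeS costar) //.
    apply: subset_trans UE _; apply/bigcupsP => t /treeS.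
    by case/(spanning_treeP e_irr).
  by rewrite leq_max (star_leq_cut e_irr treeS star) orbT.
- apply/bigmax_leqP => k /existsP[c cyc].
  by rewrite -(size_tuple c); apply: cycle_leq_clique_number.
- by apply/bigmax_leqP => K; apply: cut_leq_clique_number.
Qed.
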